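(* Let $\Omega$ be a ranked signature with a non-empty set $\Omega_0$ of constants, let $\mathcal{T}_\Omega$ be the set of ground terms over $\Omega$, and let $\mathbf{X}$ be a finite set of program variables. 1. For a ground term $s\in\mathcal{T}_\Omega$, the single equality $A s \doteq C$ has exactly one solution in which $A=\bullet$ (namely $C=s$). 2. Let $s_1\neq s_2$ be terms over $\Omega$ that both contain occurrences of the same program variable $\mathbf{x}$ (and no other program variable). If the conjunction $A s_1 \doteq C \wedge A s_2 \doteq C$ is satisfiable, then the value of $\mathbf{x}$ in any satisfying variable assignment is uniquely determined.
   Context: $\bullet$ is a fresh dedicated variable. A template is a term over $\Omega\cup\{\bullet\}$ containing at least one occurrence of $\bullet$. For a template $r$ and a term $u$, the juxtaposition $ru$ denotes $r[u/\bullet]$, the result of substituting $u$ for all occurrences of $\bullet$ in $r$. $A$ is a template variable (ranging over templates) and $C$ is a ground template variable (ranging over ground terms). A variable assignment $\sigma$ maps each program variable and $C$ to a ground term and $A$ to a template; it is extended homomorphically to terms (identity on symbols of $\Omega$), with $\sigma(At)=\sigma(A)\,\sigma(t)$. $\sigma$ satisfies $e_1\doteq e_2$ iff $\sigma(e_1)=\sigma(e_2)$, and satisfies a conjunction iff it satisfies every conjunct; a conjunction is satisfiable if some variable assignment satisfies it. A solution of an equality without program variables is an assignment of values to its template variables satisfying it. *)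

(* Defs.v *)
From mathcomp Require Import all_boot.

Set Implicit Arguments.
Unset Strict Implicit.
Unset Printing Implicit Defensive.

Record signature := Signature { symbol :> Type; arity : symbol -> nat }.

(* [V] is the set of variables.  Arguments are stored in a finite function, so
   that Leibniz equality of terms is syntactic equality. *)
Inductive term (Om : signature) (V : Type) : Type :=
| Var of V
| Op (f : Om) of {ffun 'I_(arity f) -> term Om V}.
Arguments Var {Om V} v.
Arguments Op {Om V} f ts.

Fixpoint occurs (Om : signature) (V : eqType) (x : V) (t : term Om V) : bool :=
  match t with
  | Var y => x == y
  | Op f ts => [exists i, occurs x (ts i)]
  end.

Fixpoint subst (Om : signature) (V W : Type) (h : V -> term Om W)
    (t : term Om V) : term Om W :=
  match t with
  | Var x => h x
  | Op f ts => Op f [ffun i => subst h (ts i)]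
  end.

Definition ground (Om : signature) : Type := term Om void.

(* The only variable of a [term Om unit] plays the role of the hole. *)
Definition template (Om : signature) : Type := {r : term Om unit | occurs tt r}.

Definition bullet (Om : signature) : template Om :=
  exist _ (Var tt) (eqxx tt).
Arguments bullet {Om}.

Definition fill (Om : signature) (r : template Om) (u : ground Om) : ground Om :=
  subst (fun=> u) (val r).

(* Terms in which the template variable A (applied to an argument) and the
   ground template variable C may also occur. *)
Inductive expr (Om : signature) (X : Type) : Type :=
| EVar of X
| EOp (f : Om) of {ffun 'I_(arity f) -> expr Om X}
| EA of expr Om X
| EC.
Arguments EVar {Om X} x.
Arguments EOp {Om X} f ts.
Arguments EA {Om X} e.
Arguments EC {Om X}.

Fixpoint expr_of_term (Om : signature) (X : Type) (t : term Om X) : expr Om X :=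
  match t with
  | Var x => EVar x
  | Op f ts => EOp f [ffun i => expr_of_term (ts i)]
  end.
Coercion expr_of_term : term >-> expr.

Inductive formula (Om : signature) (X : Type) : Type :=
| FEq of expr Om X & expr Om X
| FAnd of formula Om X & formula Om X.

Record assignment (Om : signature) (X : Type) := Assignment {
  pval : X -> ground Om;
  aval : template Om;
  cval : ground Om
}.

Fixpoint eval (Om : signature) (X : Type) (sigma : assignment Om X)
    (e : expr Om X) : ground Om :=
  match e with
  | EVar x => pval sigma x
  | EOp f es => Op f [ffun i => eval sigma (es i)]
  | EA e' => fill (aval sigma) (eval sigma e')
  | EC => cval sigma
  end.

Fixpoint satisfies (Om : signature) (X : Type) (sigma : assignment Om X)
    (phi : formula Om X) : Prop :=
  match phi with
  | FEq e1 e2 => eval sigma e1 = eval sigma e2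
  | FAnd phi1 phi2 => satisfies sigma phi1 /\ satisfies sigma phi2
  end.

Definition satisfiable (Om : signature) (X : Type) (phi : formula Om X) : Prop :=
  exists sigma, satisfies sigma phi.

(* Formulas over [void] are those without program variables; a solution is a
   pair of values for A and C. *)
Definition solution (Om : signature) (phi : formula Om void)
    (ac : template Om * ground Om) : Prop :=
  satisfies (Assignment (of_void (ground Om)) ac.1 ac.2) phi.

(* Main.v *)
Require Import Defs.
From mathcomp Require Import all_boot.
From Stdlib Require Import Classical.

Set Implicit Arguments.
Unset Strict Implicit.
Unset Printing Implicit Defensive.

(** Filling a template is injective, because a template contains a hole; hence
    [A s1 = C] and [A s2 = C] say that the value [v] of [x] unifies [s1] and
    [s2].  Two distinct values unifying [s1] and [s2] force [s1 = s2], by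
    descending along common head symbols: the only other case is [x] against
    [t = f(...)], where either [x] occurs in [t], and then the size of [v]
    makes [v = t[v/x]] impossible, or [t] is ground and determines [v]. *)

Lemma term_induction (Om : signature) (V : Type) (P : term Om V -> Prop) :
  (forall x, P (Var x)) ->
  (forall f (ts : {ffun 'I_(arity f) -> term Om V}),
     (forall i, P (ts i)) -> P (Op f ts)) ->
  forall t, P t.
Proof.
move=> PVar POp; fix IH 1; case=> [x|f ts]; first exact: PVar.
by apply: POp => i; apply: IH.
Qed.

(* Reading the arguments off by position avoids the dependent equality that
   injectivity of [Op] yields when the symbols have no decidable equality. *)
Definition child (Om : signature) (V : Type) (k : nat) (t : term Om V) :
    option (term Om V) :=
  if t is Op f ts then omap (fun i => ts i) (insub k) else None.

Lemma Op_inj (Om : signature) (V : Type) (f : Om)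
    (ts us : {ffun 'I_(arity f) -> term Om V}) :
  Op f ts = Op f us -> ts =1 us.
Proof.
by move=> eq_tu i; have /= := congr1 (child i) eq_tu; rewrite valK => -[].
Qed.

Lemma subst_Var (Om : signature) (V : Type) (h : V -> term Om V) (t : term Om V) :
  h =1 Var -> subst h t = t.
Proof.
move=> hE; elim/term_induction: t => [x|f ts IH] //=.
by congr Op; apply/ffunP => i; rewrite ffunE IH.
Qed.

Lemma eq_subst_in (Om : signature) (V : eqType) (W : Type)
    (h h' : V -> term Om W) (t : term Om V) :
  (forall y, occurs y t -> h y = h' y) -> subst h t = subst h' t.
Proof.
elim/term_induction: t => [x|f ts IH] /= hh'; first exact: hh'.
congr Op; apply/ffunP => i; rewrite !ffunE; apply: IH => y yi.
by apply: hh'; apply/existsP; exists i.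
Qed.

(** Following a path from the root to an occurrence of [x] leads to the same position in both
    results, where [u] itself is found. *)
Lemma subst_const_inj (Om : signature) (V : eqType) (W : Type) (x : V)
    (t : term Om V) :
  occurs x t -> injective (fun u : term Om W => subst (fun=> u) t).
Proof.
elim/term_induction: t => [y _ u v //|f ts IH /existsP[i xi] u v /= /Op_inj/(_ i)].
by rewrite !ffunE; apply: IH.
Qed.

Lemma fill_inj (Om : signature) (r : template Om) : injective (fill r).
Proof. exact: subst_const_inj (valP r). Qed.

Fixpoint term_size (Om : signature) (V : Type) (t : term Om V) : nat :=
  if t is Op f ts then (sumn (codom (fun i => term_size (ts i)))).+1 else 0.

Lemma term_size_child (Om : signature) (V : Type) (f : Om)
    (ts : {ffun 'I_(arity f) -> term Om V}) (i : 'I_(arity f)) :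
  term_size (ts i) < term_size (Op f ts).
Proof. by rewrite /= ltnS sumnE big_image (bigD1 i) //= leq_addr. Qed.

Lemma term_size_subst (Om : signature) (V : eqType) (W : Type)
    (h : V -> term Om W) (x : V) (t : term Om V) :
  occurs x t -> term_size (h x) <= term_size (subst h t).
Proof.
elim/term_induction: t => [y /eqP ->|f ts IH /existsP[i xi]] //.
apply: leq_trans (IH i xi) _; apply: ltnW.
have := term_size_child [ffun j => subst h (ts j)] i.
by rewrite ffunE.
Qed.

(** An occurrence of [x] would lie inside some argument, making [h x] no larger than a term strictly
    smaller than [h x]. *)
Lemma occurs_check (Om : signature) (V : eqType) (W : Type)
    (h : V -> term Om W) (x : V) (f : Om)
    (ts : {ffun 'I_(arity f) -> term Om V}) :
  h x = subst h (Op f ts) -> ~~ occurs x (Op f ts).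
Proof.
move=> hx; apply/negP => /existsP[i xi].
have := term_size_child [ffun j => subst h (ts j)] i.
by rewrite ffunE ltnNge -[Op _ _]/(subst h (Op f ts)) -hx term_size_subst.
Qed.

(** The occurs check excludes the only variable allowed in the right-hand side, which is therefore
    ground and has the same image under [h] and [h']. *)
Lemma unifier_Var_Op (Om : signature) (V : eqType) (W : Type)
    (h h' : V -> term Om W) (x : V) (f : Om)
    (ts : {ffun 'I_(arity f) -> term Om V}) :
  (forall y, occurs y (Op f ts) -> y = x) ->
  h x = subst h (Op f ts) -> h' x = subst h' (Op f ts) -> h x = h' x.
Proof.
move=> only_x hx h'x; rewrite hx h'x; apply: eq_subst_in => y yt.
by have := occurs_check hx; rewrite -(only_x y yt) yt.
Qed.

Lemma two_unifiers_eq (Om : signature) (V : eqType) (W : Type)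
    (h h' : V -> term Om W) (x : V) (s t : term Om V) :
  h x <> h' x ->
  (forall y, occurs y s || occurs y t -> y = x) ->
  subst h s = subst h t -> subst h' s = subst h' t -> s = t.
Proof.
move=> hx; elim/term_induction: s t => [y|f ts IH] [z|g us] only_x.
- have -> : y = x by apply: only_x; rewrite /= eqxx.
  by have -> : z = x by apply: only_x; rewrite /= eqxx orbT.
- have -> : y = x by apply: only_x; rewrite /= eqxx.
  move=> hE h'E; case: hx.
  by apply: unifier_Var_Op hE h'E => w wt; apply: only_x; rewrite wt orbT.
- have -> : z = x by apply: only_x; rewrite /= eqxx orbT.
  move=> hE h'E; case: hx.
  by apply: unifier_Var_Op (esym hE) (esym h'E) => w wt; apply: only_x; rewrite wt.
move=> /= hE h'E; have fg : f = g by case: hE.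
(* Identifying [g] with [f] gives both argument families one index type, so that they can be
   compared pointwise. *)
case: g / fg us only_x hE h'E => us only_x /Op_inj hE /Op_inj h'E.
congr Op; apply/ffunP => i; apply: IH.
- move=> y /orP[yi|yi]; apply: only_x; apply/orP; [left|right];
    by apply/existsP; exists i.
- by have := hE i; rewrite !ffunE.
- by have := h'E i; rewrite !ffunE.
Qed.

Lemma eval_term (Om : signature) (X : Type) (sigma : assignment Om X)
    (t : term Om X) :
  eval sigma t = subst (pval sigma) t.
Proof.
elim/term_induction: t => [x|f ts IH] //=.
by congr Op; apply/ffunP => i; rewrite !ffunE IH.
Qed.

Theorem theorem1 (Om : signature) (X : finType)
    (hOm0 : exists c : Om, arity c = 0) :
  (forall s : ground Om,
     unique (fun ac : template Om * ground Om =>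
               solution (FEq (EA s) EC) ac /\ ac.1 = bullet)
            (bullet, s))
  /\
  (forall (s1 s2 : term Om X) (x : X),
     s1 <> s2 ->
     occurs x s1 -> occurs x s2 ->
     (forall y : X, occurs y s1 || occurs y s2 -> y = x) ->
     let phi := FAnd (FEq (EA s1) EC) (FEq (EA s2) EC) in
     satisfiable phi ->
     exists! v : ground Om,
       forall sigma : assignment Om X, satisfies sigma phi -> pval sigma x = v).
Proof.
split=> [s|s1 s2 x neq_s _ _ only_x phi [sigma0 sat0]].
  have bulletE c : solution (FEq (EA s) EC) (bullet, c) <-> s = c.
    (* Over [void] any substitution agrees with [Var] vacuously, so [s] evaluates to itself. *)
    by rewrite /solution /= eval_term /fill /= subst_Var => // -[].
  split=> [|[a c] [/= sol eq_a]]; first by split=> //; apply/bulletE.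
  by rewrite eq_a in sol *; move/bulletE: sol => ->.
have unifies sigma : satisfies sigma phi ->
    subst (pval sigma) s1 = subst (pval sigma) s2.
  by rewrite -!eval_term => -[/= e1 e2]; apply: (@fill_inj _ (aval sigma)); rewrite e1.
exists (pval sigma0 x); split=> [sigma sat|v]; last exact.
(* Symbols carry no decidable equality, hence neither do ground terms: the case split on the two
   values of [x] is classical. *)
apply: NNPP => neq_x; apply: neq_s.
exact: two_unifiers_eq neq_x only_x (unifies _ sat) (unifies _ sat0).
Qed.
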